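(* Suppose there exist $\varepsilon>0$ and a constant $C$ such that for every positive integer $n$, every skew corner-free set $S\subseteq[n]^2$ satisfies $|S|\le C n^{4/3-\varepsilon}$. Then the following statement is false: there exist an increasing sequence of positive integers $n_1<n_2<\cdots$ and, for each $t$, a finite abelian group $G_t$ together with $n_t$ pairs $(A_{t,i},B_{t,i})_{i=1}^{n_t}$ of subsets of $G_t$ satisfying the SDPP, such that $\log|G_t|/\log n_t\to 2$ and $\min_i \log(|A_{t,i}||B_{t,i}|)/\log n_t\to 2$ as $t\to\infty$.
   Context: $[n]=\{1,\dots,n\}$. A set $S\subseteq[n]^2$ is skew corner-free if it contains no three points of the form $(x,y),(x,y+\delta),(x+\delta,y')$ with $\delta\neq0$. For a group $G$ (multiplicative, identity $1$), pairs of subsets $(A_i,B_i)_{i=1}^m$ satisfy the simultaneous double product property (SDPP) if (1) for every $i$, $aa'^{-1}=bb'^{-1}$ with $a,a'\in A_i$, $b,b'\in B_i$ only has the solution $a=a'$, $b=b'$; and (2) whenever $a_i(a'_j)^{-1}b_j(b'_l)^{-1}=1$ with $a_i\in A_i$, $a'_j\in A_j$, $b_j\in B_j$, $b'_l\in B_l$, then $i=l$. The refuted statement is Conjecture 4.7 of Cohn–Kleinberg–Szegedy–Umans (''for arbitrarily large $n$ there is an abelian group of order $n^{2-o(1)}$ and $n$ pairs $A_i,B_i$ with $|A_i||B_i|>n^{2-o(1)}$ satisfying the SDPP''). *)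

(* Defs.v *)
From HB Require Import structures.
From mathcomp Require Import all_boot all_order all_algebra all_fingroup.
From mathcomp Require Import all_classical all_reals all_analysis.

Set Implicit Arguments.
Unset Strict Implicit.
Unset Printing Implicit Defensive.

Import Order.TTheory GRing.Theory Num.Theory.
Import numFieldNormedType.Exports.

Local Open Scope classical_set_scope.
Local Open Scope ring_scope.

(* [n] = {1, .., n} is represented by 'I_n = {0, .., n-1}; the notion is
   invariant under this translation. The difference d is an integer of either
   sign, and y' is arbitrary. *)
Definition skew_corner_free (n : nat) (S : {set 'I_n * 'I_n}) : Prop :=
  ~ exists (x y yd xd y' : 'I_n) (d : int),
      [/\ d != 0, yd%:Z = y%:Z + d & xd%:Z = x%:Z + d] /\
      [/\ (x, y) \in S, (x, yd) \in S & (xd, y') \in S].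

Definition SDPP (gT : finGroupType) (m : nat) (A B : 'I_m -> {set gT}) : Prop :=
  (forall (i : 'I_m) (a a' b b' : gT),
      a \in A i -> a' \in A i -> b \in B i -> b' \in B i ->
      (a * a'^-1 = b * b'^-1)%g -> a = a' /\ b = b') /\
  (forall (i j l : 'I_m) (a a' b b' : gT),
      a \in A i -> a' \in A j -> b \in B j -> b' \in B l ->
      (a * a'^-1 * b * b'^-1 = 1)%g -> i = l).

(* The default value of the iterated minimum is itself one of the values of f,
   so this is min_i f i. *)
Definition min_ord (R : realType) (n : nat) (n_gt0 : (0 < n)%N)
    (f : 'I_n -> R) : R :=
  \big[Num.min/f (Ordinal n_gt0)]_(i < n) f i.

(* Since ln 0 = 0, an index i with A i or B i empty makes the minimum below at
   most 0; like the convention log 0 = -oo, this excludes empty sets for all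
   large t. The value at n t = 1 (possible only for t = 0) does not affect the
   limits. *)
Definition SDPP_conjecture (R : realType) : Prop :=
  exists (n : nat -> nat) (n_gt0 : forall t, (0 < n t)%N)
         (G : nat -> finGroupType) (A B : forall t, 'I_(n t) -> {set G t}),
    [/\ forall s t : nat, (s < t)%N -> (n s < n t)%N,
        forall t, abelian [set: G t]%SET,
        forall t, SDPP (A t) (B t),
        (fun t => ln (#|G t|%:R : R) / ln ((n t)%:R : R)) @ \oo --> (2 : R) &
        (fun t => min_ord (n_gt0 t)
           (fun i => ln ((#|A t i| * #|B t i|)%:R : R) / ln ((n t)%:R : R)))
          @ \oo --> (2 : R)].

(* Main.v *)
(** If [|G| = n^(2+o(1))] and [|A_i||B_i| = n^(2-o(1))], the pairs [(a, b)]
    with [a] and [b] in the same [A_i] and [B_i] form a skew corner-free subset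
    of [G x G], of size about [|G|^(3/2)].  Let [k] be the rank of [G].

    If [2^k <= |G|^(1/16)], a mixed radix expansion with doubled radices is a
    Freiman embedding of [G] into an interval of length [2^k |G|], so the skew
    corner-free set survives in the integers and is larger than the power [4/3]
    of that length.

    If [2^k > |G|^(1/16)], then [G] contains an elementary abelian [p]-group of
    rank [k], and the slice rank method over ['F_p] applies.  A function [f]
    supported on the union of the [A_i B_i^-1] and orthogonal to all
    low-degree monomials on each coset has a matrix [f (x y^-1)] of rank
    [|G|^(1-c)].  By the SDPP this matrix contains the blocks [A_i x B_i] in
    block-diagonal position, and the averaged rank of the blocks is about
    [min (|A_i|, |B_i|)], which adds up to [n^(2-o(1))]. *)

Require Import Defs.
From HB Require Import structures.
From mathcomp Require Import all_boot all_order all_algebra all_fingroup.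
From mathcomp Require Import all_solvable mxabelem finfield.
From mathcomp Require Import all_classical all_reals all_analysis.
From mathcomp Require Import zify ring lra.

Set Implicit Arguments.
Unset Strict Implicit.
Unset Printing Implicit Defensive.

Import Order.TTheory GRing.Theory Num.Theory.
Import numFieldNormedType.Exports.

Local Open Scope ring_scope.

(** * Block ranks *)

(** A matrix of rank at most [r] factors through dimension [r], and there are [#|F| ^ (r * (s + t))]
    pairs of factors. *)
Lemma card_rank_le (F : finFieldType) (s t r : nat) :
  (#|[set X : 'M[F]_(s, t) | (\rank X <= r)%N]| <= #|F| ^ (r * (s + t)))%N.
Proof.
pose f (u : 'M[F]_(s, r) * 'M[F]_(r, t)) := u.1 *m u.2.
suff sub : [set X : 'M[F]_(s, t) | (\rank X <= r)%N] \subset f @: finset.setT.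
  apply: leq_trans (subset_leq_card sub) _.
  apply: leq_trans (leq_imset_card _ _) _.
  by rewrite cardsT card_prod !card_mx -expnD mulnDr (mulnC s).
apply/fintype.subsetP => X; rewrite inE => le_r; apply/imsetP.
exists (col_ebase X *m pid_mx (\rank X), pid_mx (\rank X) *m row_ebase X) => //.
by rewrite /f /= mulmxA -(mulmxA (col_ebase X)) pid_mx_id // mulmx_ebase.
Qed.

Definition annihilator (F : finFieldType) (X J : finType) (B : {set J})
    (c : J -> X -> F) : {set {ffun X -> F}} :=
  [set f : {ffun X -> F} | [forall j in B, \sum_x f x * c j x == 0]].

Lemma annihilatorP (F : finFieldType) (X J : finType) (B : {set J})
    (c : J -> X -> F) (f : {ffun X -> F}) :
  reflect (forall j, j \in B -> \sum_x f x * c j x = 0) (f \in annihilator B c).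
Proof.
by rewrite inE; apply: (iffP forall_inP) => H j /H; [move/eqP | move->].
Qed.

Lemma annihilatorB (F : finFieldType) (X J : finType) (B : {set J})
    (c : J -> X -> F) (f g : {ffun X -> F}) :
  f \in annihilator B c -> g \in annihilator B c -> f - g \in annihilator B c.
Proof.
move=> /annihilatorP Hf /annihilatorP Hg; apply/annihilatorP => j jB.
under eq_bigr => x _ do rewrite !ffunE mulrBl.
by rewrite sumrB Hf // Hg // subr0.
Qed.

(** Counting form of the fact that [#|B|] linear conditions lower the dimension by at most [#|B|]. A
    function supported on [S] is encoded by its vector of conditions [ev f] and its difference from
    a fixed representative [rep] of that vector; the difference satisfies all the conditions. *)
Lemma card_annihilator_support (F : finFieldType) (X J : finType)
    (B : {set J}) (c : J -> X -> F) (S : {set X}) :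
  (#|F| ^ #|S| <=
   #|[set f in annihilator B c | (0%R : F).-support f \subset S]| * #|F| ^ #|B|)%N.
Proof.
pose ev (f : {ffun X -> F}) : {ffun J -> F} :=
  [ffun j => if j \in B then \sum_x f x * c j x else 0].
pose U := [set f : {ffun X -> F} | (0%R : F).-support f \subset S].
pose V := [set h : {ffun J -> F} | (0%R : F).-support h \subset B].
have cardU (Y : finType) (Z : {set Y}) :
    #|[set f : {ffun Y -> F} | (0%R : F).-support f \subset Z]| = (#|F| ^ #|Z|)%N.
  rewrite -(card_pffun_on (0 : F) (mem Z) predT) cardsE; apply: eq_card => f.
  apply/idP/idP => [fZ | /pffun_onP[] //].
  exact/pffun_onP.
pose rep h := odflt 0 [pick f in U | ev f == h].
have repP f : f \in U -> rep (ev f) \in U /\ ev (rep (ev f)) = ev f.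
  move=> fU; rewrite /rep; case: pickP => [g /andP[gU /eqP ->] // | /(_ f)].
  by rewrite fU eqxx.
pose m f := (f - rep (ev f), ev f).
have inj_m : injective m by move=> f g [+ e]; rewrite e => /addIr.
rewrite -!cardU -cardsX -(card_imset _ inj_m); apply: subset_leq_card.
apply/fintype.subsetP => _ /imsetP[f fU ->]; have [gU eg] := repP f fU.
apply/finset.setXP; split; last first.
  rewrite inE; apply/fintype.subsetP => j; rewrite !inE ffunE; case: ifP => //.
  by rewrite eqxx.
rewrite inE; apply/andP; split.
  apply/annihilatorP => j jB.
  under eq_bigr => x _ do rewrite !ffunE mulrBl.
  rewrite sumrB; apply/eqP; rewrite subr_eq0; apply/eqP.
  by move/ffunP/(_ j): eg; rewrite !ffunE jB => ->.
apply/fintype.subsetP => x; rewrite !inE !ffunE; apply: contraNT => xS.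
have zero g : g \in U -> g x = 0.
  rewrite inE => /fintype.subsetP/(_ x); rewrite inE => gS; apply/eqP.
  by apply: contraNT xS; exact: gS.
by rewrite !zero // subrr.
Qed.

Definition quot_block (F : finFieldType) (gT : finGroupType) (f : gT -> F)
    (A B : {set gT}) : 'M[F]_(#|A|, #|B|) :=
  \matrix_(x, y) f (enum_val x * (enum_val y)^-1)%g.

(* The functions supported on [A B^-1] restrict injectively to the block, and
   there are too many of them in the annihilator for all to have small rank. *)
Lemma exists_block_rank (F : finFieldType) (gT : finGroupType) (J : finType)
    (C : {set J}) (c : J -> gT -> F) (A B : {set gT}) :
  {in finset.setX A B &, injective (fun u : gT * gT => u.1 * u.2^-1)%g} ->
  exists2 g : {ffun gT -> F},
    g \in annihilator C c /\
    (0%R : F).-support g \subset [set (u.1 * u.2^-1)%g | u in finset.setX A B] &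
    (#|A| * #|B| <= \rank (quot_block g A B) * (#|A| + #|B|) + #|C|)%N.
Proof.
move=> inj.
set D := [set _ | u in _].
pose W := [set f in annihilator C c | (0%R : F).-support f \subset D].
have W0 : (0 : {ffun gT -> F}) \in W.
  rewrite inE; apply/andP; split.
    apply/annihilatorP => j _.
    by apply: big1 => x _; rewrite ffunE mul0r.
  by apply/fintype.subsetP => x; rewrite !inE ffunE eqxx.
pose rk (g : {ffun gT -> F}) := \rank (quot_block g A B).
case: (@arg_maxnP {ffun gT -> F} 0 (fun h => h \in W) rk W0) => g gW gmax.
exists g; first by move: gW; rewrite inE => /andP[].
have card_W : (#|W| <= #|F| ^ (rk g * (#|A| + #|B|)))%N.
  apply: leq_trans (card_rank_le _ _ _ _).
  rewrite -(card_in_imset (f := fun h : {ffun gT -> F} => quot_block h A B) (D := mem W)); last first.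
    move=> h h'; rewrite !inE => /andP[_ /fintype.subsetP hD] /andP[_ /fintype.subsetP hD'] /matrixP e.
    apply/ffunP => z; have [/imsetP[[a b] /finset.setXP[/= aA bB] ->] | zD] := boolP (z \in D).
      have := e (enum_rank_in aA a) (enum_rank_in bB b).
      by rewrite !mxE !enum_rankK_in.
    have /eqP -> : h z == 0 by apply: contraNT zD => hz; apply: hD; rewrite inE.
    by apply/esym/eqP; apply: contraNT zD => hz; apply: hD'; rewrite inE.
  apply/subset_leq_card/fintype.subsetP => _ /imsetP[h hW ->].
  by rewrite inE; apply: gmax.
have := leq_trans (card_annihilator_support C c D) (leq_mul card_W (leqnn _)).
rewrite -expnD leq_exp2l ?finNzRing_gt1 //.
by rewrite card_in_imset // cardsX.
Qed.

(* Averaging over [x in W]: [rk (g i) <= rk x + rk (x + g i)], and [x + g i] is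
   as uniform on [W] as [x], so a single member of [W] is simultaneously good for
   a constant proportion of the indices. *)
Lemma sum_translate_rank (F : finFieldType) (X I : finType) (W : {set {ffun X -> F}})
    (rk : I -> {ffun X -> F} -> nat) (g : I -> {ffun X -> F}) (m : nat) :
  0 \in W -> (forall i, g i \in W) ->
  (forall x y, x \in W -> y \in W -> x - y \in W) ->
  (forall i x y, (rk i y <= rk i x + rk i (x + y)%R)%N) ->
  (forall x, x \in W -> (\sum_i rk i x <= m)%N) ->
  (\sum_i rk i (g i) <= 2 * m)%N.
Proof.
move=> W0 gW WB rkD rkm.
have WD i x : (x + g i \in W) = (x \in W).
  apply/idP/idP => xW; first by rewrite -(addrK (g i) x) WB.
  by rewrite -(opprK (g i)) WB // -sub0r WB.
have W_gt0 : (0 < #|W|)%N by apply/card_gt0P; exists 0.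
rewrite -(leq_pmul2l W_gt0) -sum_nat_const mulnCA mul2n -addnn.
have -> : (\sum_(x in W) \sum_i rk i (g i) = \sum_i \sum_(x in W) rk i (g i))%N.
  exact: exchange_big.
have rkW : (\sum_i \sum_(x in W) rk i x <= #|W| * m)%N.
  rewrite exchange_big -sum_nat_const /=.
  by apply: leq_sum => x xW; exact: rkm.
apply: leq_trans (leq_add rkW rkW).
rewrite -big_split; apply: leq_sum => i _ /=.
rewrite [X in (_ <= _ + X)%N](reindex_inj (addIr (g i))) /=.
under [X in (_ <= _ + X)%N]eq_bigl do rewrite WD.
by rewrite -big_split; apply: leq_sum => x _; exact: rkD.
Qed.

(** The blocks sit in block-diagonal position inside the full quotient matrix. Padded by zeros to
    full size, they have independent row spaces, all contained in the row space of [M] cut to the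
    columns of the union of the [B i]. *)
Lemma rank_quot_blocks (F : finFieldType) (gT : finGroupType) (f : gT -> F)
    (n : nat) (A B : 'I_n -> {set gT}) :
  (forall i l a b, i != l -> a \in A i -> b \in B l -> f (a * b^-1)%g = 0) ->
  (\sum_i \rank (quot_block f (A i) (B i)) <=
   \rank (\matrix_(x, y) f (enum_val x * (enum_val y)^-1)%g : 'M[F]_#|gT|))%N.
Proof.
move=> f0; set M := (X in (_ <= \rank X)%N).
pose E (S : {set gT}) : 'M[F]_#|gT| :=
  diag_mx (\row_x (enum_val x \in S)%:R).
pose Mi i := E (A i) *m M *m E (B i).
pose S := M *m E (\bigcup_i B i)%SET.
have MiE i x y : Mi i x y = (enum_val x \in A i)%:R *
    f (enum_val x * (enum_val y)^-1)%g * (enum_val y \in B i)%:R.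
  by rewrite /Mi mul_mx_diag mul_diag_mx !mxE.
clearbody Mi.
have Mi_block i : (\rank (quot_block f (A i) (B i)) <= \rank (Mi i))%N.
  pose P : 'M[F]_(#|A i|, #|gT|) := \matrix_(u, x) (enum_val u == enum_val x)%:R.
  pose Q : 'M[F]_(#|gT|, #|B i|) := \matrix_(x, u) (enum_val u == enum_val x)%:R.
  suff -> : quot_block f (A i) (B i) = P *m Mi i *m Q.
    exact: leq_trans (mxrankM_maxl _ _) (mxrankM_maxr _ _).
  apply/matrixP => u v; rewrite !mxE (bigD1 (enum_rank (enum_val v))) //=.
  rewrite !mxE (bigD1 (enum_rank (enum_val u))) //= !mxE !enum_rankK !eqxx.
  rewrite MiE !enum_rankK !enum_valP.
  rewrite big1 ?addr0 => [|x /negPf nx]; last first.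
    rewrite !mxE (_ : (_ == _) = false) ?mul0r //.
    by apply/negP => /eqP e; rewrite -(enum_valK x) -e eqxx in nx.
  rewrite big1 ?addr0 => [|x /negPf nx]; last first.
    rewrite !mxE (_ : (_ == _) = false) ?mulr0 //.
    by apply/negP => /eqP e; rewrite -(enum_valK x) -e eqxx in nx.
  by rewrite mulr1 !mul1r mulr1.
(* On a row in [A i] the entries outside [B i] but inside the union vanish, so cutting to the union
   has the same effect as cutting to [B i]. *)
have MiS i : (Mi i <= S)%MS.
  apply/submxP; exists (E (A i)); rewrite /S mulmxA.
  apply/matrixP => x y; rewrite MiE mul_mx_diag mul_diag_mx !mxE.
  have [xA | _] := boolP (enum_val x \in A i); last by rewrite !mul0r.
  have [yB | yB] := boolP (enum_val y \in B i).
    by rewrite (_ : _ \in \bigcup_i _)%SET //; apply/bigcupP; exists i.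
  have [/bigcupP[l _ yl] | //] := boolP (enum_val y \in (\bigcup_i B i)%SET).
  rewrite (f0 i l) // ?mulr0 ?mul0r //.
  by apply: contraNneq yB => ->.
(* Cutting to the columns [B i] fixes the row space of [Mi i] and kills that of every other
   [Mi j]. *)
have Midx : mxdirect (\sum_i Mi i).
  apply/mxdirect_sumsP => i _; apply/eqP/rowV0P => u.
  rewrite sub_capmx => /andP[/submxP[w ui]] uj.
  have EE : u *m E (B i) = u.
    rewrite ui -mulmxA; congr (_ *m _); apply/matrixP => x y.
    by rewrite mul_mx_diag !mxE MiE -mulrA; case: (_ \in B i); rewrite ?mulr1 ?mulr0.
  rewrite -EE; apply/eqP; rewrite -submx0.
  apply: submx_trans (submxMr _ uj) _.
  rewrite sumsmxMr; apply/sumsmx_subP => j /= ji.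
  rewrite submx0; apply/eqP/matrixP => x y; rewrite mul_mx_diag !mxE MiE.
  have [xA | _] := boolP (_ \in A j); last by rewrite !mul0r.
  have [yB | _] := boolP (enum_val y \in B i); last by rewrite mulr0.
  by rewrite (f0 j i) // mulr0 !mul0r.
apply: (@leq_trans (\sum_i \rank (Mi i))); first by apply: leq_sum.
rewrite -(mxdirectP Midx) /=; apply: leq_trans (mxrankM_maxl M _).
by apply: mxrankS; apply/sumsmx_subP => i _; exact: MiS.
Qed.

(** * Slice rank *)

(* [n] stands for [p.-1]: the exponents run over [0 .. p-1], and low means degree
   at most one third of the maximum [n * k]. *)
Definition low_exponents (n k : nat) : {set {ffun 'I_k -> 'I_n.+1}} :=
  [set e : {ffun 'I_k -> 'I_n.+1} | (3 * \sum_i e i <= n * k)%N].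

Lemma exprD_widen (F : comNzRingType) (m n : nat) (u x : F) : (m <= n)%N ->
  (u + x) ^+ m = \sum_(b < n.+1) x ^+ b * u ^+ (m - b) *+ 'C(m, b).
Proof.
move=> le_mn; rewrite exprDn.
under eq_bigr => i _ do rewrite mulrC.
rewrite (big_ord_widen n.+1 (fun i => x ^+ i * u ^+ (m - i) *+ 'C(m, i))) //.
rewrite big_mkcond; apply: eq_bigr => b _; rewrite ltnS.
by case: leqP => // lt_mb; rewrite bin_small // mulr0n.
Qed.

(** Multinomial expansion in [z], [x], [y], with the powers of [w] absorbed into the coefficients.
    The degree bound later forces one of the three variables to have low degree. *)
Lemma indicator_expansion (F : comNzRingType) (n : nat) :
  exists C : F -> 'I_n.+1 * 'I_n.+1 * 'I_n.+1 -> F,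
  (forall w j, C w j != 0 -> (j.1.1 + j.1.2 + j.2 <= n)%N) /\
  (forall z x y w, 1 - (z + x + y + w) ^+ n =
     \sum_j C w j * (z ^+ j.1.1 * x ^+ j.1.2 * y ^+ j.2)).
Proof.
(* The multinomial coefficient is a product of binomials, which vanishes whenever one of the
   truncated subtractions would matter. *)
pose D (w : F) (a b c : nat) : F :=
  w ^+ (n - a - b - c) *+ ('C(n, a) * 'C(n - a, b) * 'C(n - a - b, c)).
exists (fun w j => (j == (ord0, ord0, ord0))%:R - D w j.1.1 j.1.2 j.2); split.
  move=> w [[a b] c] /=.
  have [[-> -> ->] // | _] := eqVneq (a, b, c) (ord0, ord0, ord0).
  rewrite sub0r oppr_eq0 /D.
  have [lt_na | le_an] := ltnP n a; first by rewrite bin_small // !mul0n mulr0n eqxx.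
  have [lt_nb | le_bn] := ltnP (n - a) b.
    by rewrite (bin_small lt_nb) muln0 mul0n mulr0n eqxx.
  have [lt_nc | le_cn] := ltnP (n - a - b) c.
    by rewrite (bin_small lt_nc) muln0 mulr0n eqxx.
  by move=> _; lia.
move=> z x y w.
under eq_bigr => j _ do rewrite mulrBl.
rewrite sumrB; congr (_ - _).
  rewrite (bigD1 (ord0, ord0, ord0)) //= big1 ?addr0 => [|j /negPf->].
    by rewrite ?eqxx ?expr0 ?mulr1.
  by rewrite mul0r.
have -> : z + x + y + w = w + y + x + z by rewrite (addrC z) (addrC (x + z)) (addrC _ w) !addrA.
rewrite -(pair_bigA _ (fun (ab : 'I_n.+1 * 'I_n.+1) (c : 'I_n.+1) => D w ab.1 ab.2 c * (z ^+ ab.1 * x ^+ ab.2 * y ^+ c))) /=.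
rewrite -(pair_bigA _ (fun a b : 'I_n.+1 => \sum_(c < n.+1) D w a b c * (z ^+ a * x ^+ b * y ^+ c))) /=.
rewrite (exprD_widen _ _ (leqnn n)); apply: eq_bigr => a _.
rewrite (@exprD_widen _ _ n); last by lia.
rewrite mulr_sumr -sumrMnl; apply: eq_bigr => b _.
rewrite (@exprD_widen _ _ n); last by lia.
rewrite !mulrnAr mulrA mulr_sumr -!sumrMnl; apply: eq_bigr => c _.
rewrite /D mulrnAr -!mulrnA mulrnAl; congr (_ *+ _); first by rewrite mulrA mulrC.
by rewrite mulnA mulnC (mulnC 'C(n - a - b, c)) mulnA.
Qed.

Lemma Fp_indicator (p : nat) (u : 'F_p) : prime p ->
  1 - u ^+ p.-1 = (u == 0)%:R.
Proof.
move=> p_pr; have p_gt1 := prime_gt1 p_pr.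
have [-> | u0] := eqVneq u 0.
  by rewrite expr0n -subn1 subn_eq0 leqNgt p_gt1 subr0.
apply/eqP; rewrite subr_eq0 eq_sym; apply/eqP/(mulIf u0).
by rewrite -exprSr prednK ?prime_gt0 // mul1r -[X in _ ^+ X](card_Fp p_pr) expf_card.
Qed.

(** Apart from the monomial, a term depends on the row only through [t]. The matrix therefore
    factors through the index set [L] times [R], which records the monomial and the value of [t]. *)
Lemma rank_slices (F : fieldType) (X E H : finType) (t : X -> X) (R : {set X})
    (L : {set E}) (mono : E -> X -> F) (b : H -> E) (K : H -> X -> X -> F) :
  (forall x, t x \in R) ->
  (\rank (\matrix_(i < #|X|, j < #|X|)
     (\sum_(h | b h \in L) mono (b h) (enum_val i) *
        K h (t (enum_val i)) (enum_val j))%R) <= #|L| * #|R|)%N.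
Proof.
move=> tR.
pose J := finset.setX L R.
pose P : 'M[F]_(#|X|, #|J|) := \matrix_(i, j)
  (mono (enum_val j).1 (enum_val i) * (t (enum_val i) == (enum_val j).2)%:R).
pose Q : 'M[F]_(#|J|, #|X|) := \matrix_(j, i)
  \sum_(h | b h == (enum_val j).1) K h (enum_val j).2 (enum_val i).
set M := (X in (\rank X <= _)%N).
suff -> : M = P *m Q.
  by apply: leq_trans (mxrankM_maxl _ _) _; rewrite -cardsX rank_leq_col.
apply/matrixP => i j; rewrite !mxE.
under [RHS]eq_bigr => l _ do rewrite !mxE.
pose G (u : E * X) := mono u.1 (enum_val i) * (t (enum_val i) == u.2)%:R *
  \sum_(h | b h == u.1) K h u.2 (enum_val j).
rewrite -(big_enum_val G) /=.
rewrite (eq_bigl (fun u => (u.1 \in L) && (u.2 \in R))) => [|u]; last by case: u => e s; rewrite finset.in_setX.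
rewrite -(pair_big (fun e => e \in L) (fun s => s \in R) (fun e s => G (e, s))) /=.
rewrite (partition_big b (fun e => e \in L)) //=; apply: eq_bigr => e eL.
rewrite (bigD1 (t (enum_val i))) //= /G /= eqxx mulr1 mulr_sumr.
rewrite [X in _ = _ + X]big1 ?addr0 => [|s /andP[_ /negPf st]]; last first.
  by rewrite eq_sym st mulr0 mul0r.
rewrite (eq_bigl (fun h => b h == e)) => [|h]; last first.
  by case: eqP => [->|]; rewrite ?eL // andbF.
by apply: eq_bigr => h /eqP->.
Qed.

Lemma abelem_coordinates (p k : nat) (gT : finGroupType) (G E : {group gT}) :
  E \in pnElem p k G -> exists kappa : gT -> 'I_k -> 'F_p,
    {in E &, forall x y i, kappa (x * y)%g i = kappa x i + kappa y i} /\
    {in E &, forall x y, kappa x =1 kappa y -> x = y}.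
Proof.
case/pnElemP => _ abelE <-; have [E1 | ntE] := eqsVneq E 1%g.
  exists (fun _ _ => 0); split=> x y; first by rewrite addr0.
  by rewrite E1 !inE => /eqP-> /eqP->.
rewrite -(dim_abelemE abelE ntE).
exists (fun x i => abelem_rV abelE ntE x 0 i); split=> x y xE yE.
  by move=> i; rewrite abelem_rV_M // mxE.
by move=> e; apply: (@abelem_rV_inj _ _ _ abelE ntE) => //; apply/rowP.
Qed.

(* The indicator of [z = x / y] on a coset is a polynomial of degree [(p-1) k] in
   the coordinates of [z], [x], [y]; in each monomial one of the three has at
   most a third of the degree.  The monomials low in [z] are killed by [f]. *)
Lemma quot_rank (p k : nat) (gT : finGroupType) (E : {group gT}) :
  prime p -> abelian [set: gT]%SET -> E \in pnElem p k [set: gT]%SET ->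
  exists (J : finType) (C : {set J}) (c : J -> gT -> 'F_p),
    (#|C| * p ^ k <= #|low_exponents p.-1 k| * #|gT|)%N /\
    forall f, f \in annihilator C c ->
      (\rank (\matrix_(x, y) f (enum_val x * (enum_val y)^-1)%g : 'M['F_p]_#|gT|)
       <= 2 * #|C|)%N.
Proof.
move=> p_pr cGG Ek; have [_ _ cardE] := pnElemPcard Ek.
have [kappa [kM k_inj]] := abelem_coordinates Ek.
have [D [Ddeg Dexp]] := indicator_expansion 'F_p p.-1.
(* Every [x] splits as its [E]-part [e x] times its coset representative [t x]. *)
pose t x := repr (E :* x)%g; pose e x := (x * (t x)^-1)%g.
pose R := [set repr C | C in rcosets E [set: gT]%SET]%SET.
have tR x : t x \in R by apply/imset_f; rewrite mem_rcosets; apply/mulsgP; exists 1%g x; rewrite ?inE ?mul1g.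
have eE x : e x \in E.
  have := mem_repr_rcoset E x; rewrite -/(t x) mem_rcoset => xE.
  by rewrite /e -groupV invMg invgK.
have tE x y : (x * y^-1)%g \in E -> t x = t y.
  by rewrite -mem_rcoset => /rcoset_eqP xy; rewrite /t xy.
have com (x y : gT) : (x * y = y * x)%g.
  by have /centsP := cGG; apply; rewrite inE.
have quotMM (a b c d : gT) : (a * b * (c * d)^-1 = a * c^-1 * (b * d^-1))%g.
  by rewrite invMg -!mulgA [in RHS](com c^-1%g) !mulgA.
have xyE x y : (x * y^-1 = e x * (e y)^-1 * (t x * (t y)^-1))%g.
  by rewrite -quotMM /e !mulgKV.
have t_quot x y : t (x * y^-1)%g = t (t x * (t y)^-1)%g.
  by apply: tE; rewrite (xyE x y) mulgK groupM ?groupV ?eE.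
have e_quot x y : e (x * y^-1)%g = (e x * (e y)^-1 * e (t x * (t y)^-1))%g.
  by rewrite {1}/e t_quot (xyE x y) -mulgA.
have eK z : (e z * t z)%g = z by rewrite /e mulgKV.
clearbody e.
have k1 i : kappa 1%g i = 0.
  by apply: (addIr (kappa 1%g i)); rewrite -kM ?group1 // mulg1 add0r.
have kV x i : x \in E -> kappa (x^-1)%g i = - kappa x i.
  by move=> xE; apply/eqP; rewrite -addr_eq0 -kM ?groupV // mulVg k1.
pose v z i := kappa (e z) i.
(* A quotient of two representatives need not be a representative. Evaluated at [t x] and [t y], [w]
   is the resulting correction; it depends only on the two cosets, so it may enter the
   coefficients. *)
pose w x y i := kappa (e (x * y^-1)%g) i.
pose mz (a : {ffun 'I_k -> 'I_p.-1.+1}) z := \prod_i v z i ^+ a i.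
pose mx (a : {ffun 'I_k -> 'I_p.-1.+1}) z := \prod_i (- v z i) ^+ a i.
pose C := finset.setX (low_exponents p.-1 k) R.
exists ({ffun 'I_k -> 'I_p.-1.+1} * gT)%type, C.
(* One condition for each low monomial on each coset of [E]. *)
exists (fun j z => mz j.1 z * (t z == j.2)%:R); split.
  rewrite cardsX -mulnA leq_mul2l -cardE; apply/orP; right.
  apply: (@leq_trans (#|rcosets E [set: gT]%SET| * #|E|)).
    by rewrite leq_mul2r leq_imset_card orbT.
  by rewrite -[X in (_ <= X)%N]cardsT mulnC Lagrange ?finset.subsetT.
move=> f /annihilatorP f0.
pose Ha (h : {ffun 'I_k -> 'I_p.-1.+1 * 'I_p.-1.+1 * 'I_p.-1.+1}) := [ffun i => (h i).1.1].
pose Hb (h : {ffun 'I_k -> 'I_p.-1.+1 * 'I_p.-1.+1 * 'I_p.-1.+1}) := [ffun i => (h i).1.2].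
pose Hc (h : {ffun 'I_k -> 'I_p.-1.+1 * 'I_p.-1.+1 * 'I_p.-1.+1}) := [ffun i => (h i).2].
pose T (h : {ffun 'I_k -> 'I_p.-1.+1 * 'I_p.-1.+1 * 'I_p.-1.+1}) x y := (\prod_i D (- w x y i) (h i)) *
  \sum_z f z * (mz (Ha h) z * (t z == t (x * y^-1)%g)%:R).
(* If [Ha h] is low, the inner sum is one of the conditions on [f] and vanishes. Otherwise, as the
   three degrees add up to at most [p.-1 * k], the other two cannot both exceed a third of it. *)
have T0 h x y : T h x y != 0 ->
    (Hb h \in low_exponents p.-1 k) || (Hc h \in low_exponents p.-1 k).
  rewrite mulf_eq0 negb_or prodf_seq_neq0 => /andP[/allP Dh].
  have [ha | ha] := boolP (Ha h \in low_exponents p.-1 k).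
    by rewrite (f0 (Ha h, t (x * y^-1)%g)) ?eqxx //; apply/finset.setXP; split; last exact: tR.
  move=> _; apply: contraR ha; rewrite negb_or !inE -!ltnNge => /andP[hb hc].
  have : (\sum_i ((h i).1.1 + (h i).1.2 + (h i).2) <= p.-1 * k)%N.
    rewrite mulnC -[X in (_ <= X * _)%N](card_ord k) -sum_nat_const.
    apply: leq_sum => i _; apply: (Ddeg (- w x y i)).
    exact: Dh (mem_index_enum i).
  have ffE (g : 'I_p.-1.+1 * 'I_p.-1.+1 * 'I_p.-1.+1 -> 'I_p.-1.+1) :
      (\sum_i nat_of_ord ([ffun i => g (h i)] i) = \sum_i nat_of_ord (g (h i)))%N.
    by apply: eq_bigr => i _; rewrite ffunE.
  rewrite !big_split /=; move: hb hc; 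
  rewrite (ffE (fun j => j.1.1)) (ffE (fun j => j.1.2)) (ffE snd) /=; lia.
have fE x y : f (x * y^-1)%g =
    \sum_(h : {ffun 'I_k -> 'I_p.-1.+1 * 'I_p.-1.+1 * 'I_p.-1.+1}) T h (t x) (t y) * (mx (Hb h) x * mz (Hc h) y).
  (* On the coset of [x * y^-1], the product tests coordinate by coordinate whether [z] equals
     [x * y^-1]. *)
  have -> : f (x * y^-1)%g = \sum_z f z * ((t z == t (t x * (t y)^-1)%g)%:R *
      \prod_i (1 - (v z i + (- v x i) + v y i + (- w (t x) (t y) i)) ^+ p.-1)).
    rewrite (bigD1 (x * y^-1)%g) //= [X in _ + X]big1 ?addr0 => [|z zxy].
      rewrite -t_quot eqxx mul1r big1 ?mulr1 // => i _.
      rewrite Fp_indicator // /v e_quot !kM ?groupM ?groupV ?eE // kV ?eE // /w.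
      by rewrite (_ : _ + _ = 0) ?eqxx //; ring.
    rewrite -t_quot; case: eqP => [tz | _]; last by rewrite mul0r mulr0.
    rewrite mul1r; apply/eqP; rewrite mulf_eq0; apply/orP; right.
    apply: contraNT zxy => /prodf_neq0 nz; apply/eqP.
    rewrite -[z]eK -[RHS]eK tz; congr (_ * _)%g.
    apply: k_inj; rewrite ?eE // => i; have := nz i isT.
    rewrite Fp_indicator //.
    have [/subr0_eq wE _ | _] := eqVneq (v z i - v x i + v y i - w (t x) (t y) i) 0; last by rewrite eqxx.
    rewrite e_quot !kM ?groupM ?groupV ?eE // kV ?eE //.
    by rewrite -/(w (t x) (t y) i) -wE /v; ring.
  under eq_bigr => z _ do under eq_bigr => i _ do rewrite Dexp.
  under eq_bigr => z _ do rewrite bigA_distr_bigA /= mulr_sumr mulr_sumr.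
  rewrite exchange_big /=; apply: eq_bigr => h _.
  rewrite /T mulr_sumr mulr_suml; apply: eq_bigr => z _.
  rewrite !big_split /= /mz /mx.
  under [X in _ = _ * (_ * (X * _)) * _]eq_bigr => i _ do rewrite ffunE.
  under [X in _ = _ * (X * _)]eq_bigr => i _ do rewrite ffunE.
  under [X in _ = _ * (_ * X)]eq_bigr => i _ do rewrite ffunE.
  by ring.
(* Indices with [Hb h] low are sliced along [x], the remaining nonzero ones along [y]; the indicator
   in [K2] prevents counting an index twice. Each family contributes rank at most [#|C|]. *)
pose K1 h x y := T h x (t y) * mz (Hc h) y.
pose K2 h y x := (Hb h \notin low_exponents p.-1 k)%:R * T h (t x) y * mx (Hb h) x.
have := rank_slices (low_exponents p.-1 k) mx Hb K1 tR.
have := rank_slices (low_exponents p.-1 k) mz Hc K2 tR.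
set M2 := (X in (\rank X <= _)%N -> _); set M1 := (X in _ -> (\rank X <= _)%N -> _).
move=> rk2 rk1; rewrite mul2n -addnn cardsX.
apply: leq_trans (leq_add rk1 rk2); rewrite -(mxrank_tr M2).
apply: leq_trans (mxrank_add _ _); apply: mxrankS.
rewrite (_ : M1 + _ = \matrix_(x, y) f (enum_val x * (enum_val y)^-1)%g) //.
apply/matrixP => i j; rewrite !mxE fE.
set x := enum_val i; set y := enum_val j.
rewrite [in LHS]big_mkcond [X in _ + X]big_mkcond -big_split /=.
apply: eq_bigr => h _; rewrite /K1 /K2.
have [hb | hb] := boolP (Hb h \in _).
  by rewrite mul0r mul0r mulr0 if_same addr0; ring.
case: ifP => [_ | hc]; first by rewrite mul1r add0r; ring.
have [-> | /T0] := eqVneq (T h (t x) (t y)) 0; first by rewrite mul0r addr0.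
by rewrite hc (negPf hb).
Qed.

(* Chernoff's bound with the weight [u ^ degree] where [u ^ n = 1/2]; pairing [j]
   with [n - j] bounds the mean of [u ^ j] by [3/4], and [(3/4)^3 * 2 = 27/32]. *)
Lemma card_low_exponents (R : realType) (n k : nat) : (0 < n)%N ->
  32 ^+ k * #|low_exponents n k|%:R ^+ 3 <= 27 ^+ k * (n.+1%:R ^+ k) ^+ 3 :> R.
Proof.
move=> n_gt0; pose u : R := expR (- (ln 2 / n%:R)).
have n0 : n%:R != 0 :> R by rewrite pnatr_eq0 -lt0n.
have ln2_gt0 : 0 < ln 2 :> R by rewrite ln_gt0 // ltr1n.
have un : u ^+ n = 2^-1.
  by rewrite /u -expRM_natl mulrN mulrC divfK // expRN lnK // posrE.
have u_gt0 : 0 < u by exact: expR_gt0.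
have u_le1 : u <= 1.
  by rewrite -[leRHS]expR0 ler_expR oppr_le0 divr_ge0 // ltW.
have sum_u : \sum_(j < n.+1) u ^+ j <= n.+1%:R * (3 / 4).
  have pair j : (j <= n)%N -> u ^+ j + u ^+ (n - j) <= 3 / 2.
    move=> le_jn; have : 0 <= (1 - u ^+ j) * (1 - u ^+ (n - j)).
      by rewrite mulr_ge0 // subr_ge0 exprn_ile1 // ltW.
    have : u ^+ j * u ^+ (n - j) = 2^-1 by rewrite -exprD subnKC.
    by move: (u ^+ j) (u ^+ (n - j)) => a b; nra.
  have : (\sum_(j < n.+1) u ^+ j) + (\sum_(j < n.+1) u ^+ j) <= n.+1%:R * (3 / 2).
    rewrite [X in X + _](reindex_inj rev_ord_inj) -big_split /=.
    apply: (@le_trans _ _ (\sum_(j < n.+1) (3 / 2))).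
      by apply: ler_sum => j _; rewrite subSS addrC pair // -ltnS.
    by rewrite sumr_const card_ord -[leLHS]mulr_natl.
  by move=> ?; lra.
(* This is the weight [u ^ degree] at the threshold degree [n * k / 3], hence a lower bound for the
   weight of each low exponent. *)
pose c : R := expR (- (ln 2 * (k%:R / 3))).
have c3 : c ^+ 3 = 2^-1 ^+ k.
  rewrite /c -expRM_natl -[in RHS](@lnK _ 2) ?posrE // -expRN -expRM_natl.
  by congr expR; field.
have sum_low : #|low_exponents n k|%:R * c <= (n.+1%:R * (3 / 4)) ^+ k.
  apply: (@le_trans _ _ (\sum_(e in low_exponents n k) u ^+ (\sum_i e i)%N)).
    rewrite mulr_natl -sumr_const; apply: ler_sum => e; rewrite inE => le_e.
    rewrite /u -expRM_natl ler_expR mulrN lerN2 mulrCA ler_pM2l //.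
    rewrite ler_pdivrMr ?ltr0n // mulrAC ler_pdivlMr // -!natrM ler_nat.
    by rewrite mulnC (mulnC k).
  apply: (@le_trans _ _ (\sum_(e : {ffun 'I_k -> 'I_n.+1}) \prod_i u ^+ e i)).
    rewrite big_mkcond; apply: ler_sum => e _; rewrite -prodrXr.
    by case: ifP => // _; apply: prodr_ge0 => i _; rewrite exprn_ge0 // ltW.
  rewrite -(bigA_distr_bigA (fun _ (j : 'I_n.+1) => u ^+ j)) /=.
  rewrite prodr_const card_ord lerXn2r // nnegrE.
    by apply: sumr_ge0 => j _; rewrite exprn_ge0 // ltW.
  by rewrite mulr_ge0 // divr_ge0.
have := @lerXn2r R 3 _ _ _ _ sum_low.
rewrite !nnegrE => /(_ _ _)/wrap[]; first by rewrite mulr_ge0 // ltW ?expR_gt0.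
  by rewrite exprn_ge0 // mulr_ge0 // divr_ge0.
rewrite exprMn c3 exprMn [X in _ <= X]exprMn => le3.
have -> : (32 : R) ^+ k = 64 ^+ k * 2^-1 ^+ k by rewrite -exprMn; congr (_ ^+ k); field.
have -> : (27 : R) ^+ k = 64 ^+ k * ((3 / 4) ^+ k) ^+ 3.
  by rewrite exprAC -exprMn; congr (_ ^+ k); field.
rewrite -[leLHS]mulrA -[leRHS]mulrA ler_pM2l ?exprn_gt0 //.
by rewrite [leLHS]mulrC [leRHS]mulrC.
Qed.

(** [M] counts the conditions of [quot_rank] for a prime whose [p]-rank is the full rank of the
    group. A function of high rank is chosen for each block separately; averaging then compares all
    of them with single functions, whose total block rank is at most [2 * M]. *)
Lemma SDPP_rank_bound (R : realType) (gT : finGroupType) (n : nat)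
    (A B : 'I_n -> {set gT}) :
  abelian [set: gT]%SET -> SDPP A B ->
  exists (M : nat) (r : 'I_n -> nat),
    [/\ 32 ^+ 'r([set: gT]%SET)%g * M%:R ^+ 3
          <= 27 ^+ 'r([set: gT]%SET)%g * #|gT|%:R ^+ 3 :> R,
        (\sum_i r i <= 4 * M)%N &
        forall i, (#|A i| * #|B i| <= r i * (#|A i| + #|B i|) + M)%N].
Proof.
move=> cGG [sdpp1 sdpp2].
have com (x y : gT) : (x * y = y * x)%g.
  by have /centsP := cGG; apply; rewrite inE.
have [p p_pr rE] := rank_witness [set: gT]%G.
have [E Ek] := p_rank_witness p [set: gT]%G.
rewrite -rE in Ek; set k := 'r(_)%g in Ek *.
have [J [C [c [cardC rkC]]]] := quot_rank p_pr cGG Ek.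
exists #|C|.
(* In an abelian group this is the first SDPP condition, rearranged. *)
have inj i : {in finset.setX (A i) (B i) &, injective (fun u : gT * gT => u.1 * u.2^-1)%g}.
  move=> [a b] [a' b'] /finset.setXP[/= aA bB] /finset.setXP[/= aA' bB'] e.
  have [] := sdpp1 i a a' b b' aA aA' bB bB'; last by move=> -> ->.
  by rewrite -(mulgKV b a) e (com _ a'^-1)%g -(mulgA a') mulKg com.
have exg i : exists g : {ffun gT -> 'F_p}, [/\ g \in annihilator C c,
    (0 : 'F_p).-support g \subset [set (u.1 * u.2^-1)%g | u in finset.setX (A i) (B i)] &
    (#|A i| * #|B i| <= \rank (quot_block g (A i) (B i)) * (#|A i| + #|B i|) + #|C|)%N].
  by have [h [? ?] ?] := exists_block_rank C c (inj i); exists h.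
have [g gP] := fin_all_exists exg.
exists (fun i => \rank (quot_block (g i) (A i) (B i))); split; last by move=> i; have [] := gP i.
  have p_gt0 := prime_gt0 p_pr.
  have pk_gt0 : 0 < (p ^ k)%:R ^+ 3 :> R by rewrite exprn_gt0 // ltr0n expn_gt0 p_gt0.
  have p1_gt0 : (0 < p.-1)%N by rewrite -ltnS prednK // prime_gt1.
  rewrite -(ler_pM2r pk_gt0) -[leLHS]mulrA -[leRHS]mulrA -!exprMn -natrM.
  apply: (@le_trans _ _ (32 ^+ k * (#|low_exponents p.-1 k| * #|gT|)%:R ^+ 3)).
    by rewrite ler_pM2l ?exprn_gt0 // lerXn2r ?nnegrE // ler_nat.
  have := @card_low_exponents R p.-1 k p1_gt0.
  have -> : p.-1.+1%:R = p%:R :> R by rewrite prednK.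
  move=> le_low; rewrite natrX natrM !exprMn [leLHS]mulrA.
  by rewrite [_ ^+ 3 * (_ ^+ k) ^+ 3]mulrC [leRHS]mulrA ler_wpM2r // exprn_ge0.
pose D := [set z | [exists i, z \in [set (u.1 * u.2^-1)%g | u in finset.setX (A i) (B i)]%SET]]%SET.
pose W := [set f in annihilator C c | (0 : 'F_p).-support f \subset D].
have suppP (f : {ffun gT -> 'F_p}) (S : {set gT}) :
    reflect (forall z, z \notin S -> f z = 0) ((0 : 'F_p).-support f \subset S).
  apply: (iffP fintype.subsetP) => H z; last by rewrite inE; apply: contraNT => /H ->.
  by move=> zS; apply/eqP; apply: contraNT zS => fz; apply: H; rewrite inE.
have -> : (4 * #|C| = 2 * (2 * #|C|))%N by rewrite mulnA.
have avg := @sum_translate_rank 'F_p gT 'I_n W (fun i (f : {ffun gT -> 'F_p}) => \rank (quot_block f (A i) (B i))) g (2 * #|C|).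
apply: avg.
- rewrite inE; apply/andP; split; last by apply/suppP => z _; rewrite ffunE.
  by apply/annihilatorP => j _; apply: big1 => x _; rewrite ffunE mul0r.
- move=> i; have [gC gS _] := gP i; rewrite inE gC.
  apply: fintype.subset_trans gS _; apply/fintype.subsetP => z zi.
  by rewrite inE; apply/existsP; exists i.
- move=> f h /setIdP[fC /suppP fD] /setIdP[hC /suppP hD]; apply/setIdP.
  split; first exact: annihilatorB.
  by apply/suppP => z zD; rewrite !ffunE fD // hD // subr0.
- move=> i f h.
  have -> : quot_block h (A i) (B i) = quot_block (f + h) (A i) (B i) - quot_block f (A i) (B i).
    by apply/matrixP => x y; rewrite !mxE ffunE addrAC subrr add0r.
  by rewrite addnC; apply: leq_trans (mxrank_add _ _) _; rewrite mxrank_opp.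
move=> f; rewrite inE => /andP[fC /suppP fD].
(* By the second SDPP condition, a quotient from [A i] and [B l] with [i != l] lies in no [A j]
   times the inverse of [B j], so [f] vanishes there. *)
apply: leq_trans (rkC f fC); apply: rank_quot_blocks => i l a b il aA bB.
apply: fD; rewrite inE; apply: contra il => /existsP[j /imsetP[[a' b'] /finset.setXP[/= aA' bB'] e]].
apply/eqP; apply: (sdpp2 i j l a a' b' b) => //.
have -> : (a * a'^-1 * b' * b^-1 = a * b^-1 * (a' * b'^-1)^-1)%g.
  by rewrite invMg invgK -!mulgA; congr (_ * _)%g; rewrite com (com b') mulgA.
by rewrite e mulgV.
Qed.

(** * Freiman embedding *)

(** The inverse of [phi] on its image is a Freiman homomorphism of order 2: additive relations are
    pulled back from the integers to the group, which is the direction needed to exclude corners. *)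
Definition freiman (gT : finGroupType) (G : {set gT}) (N : nat)
    (phi : gT -> nat) : Prop :=
  (forall x, x \in G -> (phi x < N)%N) /\
  (forall x x' y y', x \in G -> x' \in G -> y \in G -> y' \in G ->
     (phi x + phi y' = phi x' + phi y)%N -> (x * y' = x' * y)%g).

Lemma freiman_cycle (gT : finGroupType) (x : gT) :
  exists phi, freiman <[x]>%g #[x]%g phi.
Proof.
(* The discrete logarithm; the default 0 is taken only outside the cycle. *)
exists (fun y => if [pick n : 'I_#[x]%g | (x ^+ n == y)%g] is Some n then nat_of_ord n else 0%N).
have phiP y : y \in <[x]>%g -> exists2 n : nat, (n < #[x]%g)%N &
    y = (x ^+ n)%g /\ (if [pick n : 'I_#[x]%g | (x ^+ n == y)%g] is Some n then nat_of_ord n else 0%N) = n.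
  case/cyclePmin => n lt_n ->; case: pickP => [m /eqP em | /(_ (Ordinal lt_n))].
    by exists m; rewrite ?em.
  by rewrite eqxx.
split=> [y /phiP[n lt_n [_ ->]] //|].
move=> y y' z z' /phiP[a _ [-> ->]] /phiP[b _ [-> ->]] /phiP[c _ [-> ->]] /phiP[d _ [-> ->]] e.
by rewrite -!expgD e.
Qed.

Lemma radix_inj (m a b c d : nat) : (a < m)%N -> (b < m)%N ->
  (a + m * c = b + m * d)%N -> a = b /\ c = d.
Proof.
move=> am bm e; have m_gt0 : (0 < m)%N by apply: leq_ltn_trans am.
have eab : a = b by move/(congr1 (modn^~ m)): e; rewrite /= ![(_ + m * _)%N]addnC !(mulnC m) !modnMDl !modn_small.
split=> //; apply/eqP; rewrite -(eqn_pmul2l m_gt0).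
by rewrite -(eqn_add2l b) -e eab.
Qed.

(* Mixed radix with the radix of the first factor doubled: no carry occurs. *)
Lemma freiman_dprod (gT : finGroupType) (H C G : {group gT}) (M N : nat)
    (phi psi : gT -> nat) :
  (H \x C = G)%g -> freiman H M phi -> freiman C N psi ->
  exists chi, freiman G (2 * M * N) chi.
Proof.
move=> defG [phiM phiF] [psiN psiF].
have [_ defHC cHC tiHC] := dprodP defG.
pose dec z := [pick u : gT * gT | (u.1 \in H) && (u.2 \in C) && (u.1 * u.2 == z)%g].
pose chi z := if dec z is Some u then (phi u.1 + 2 * M * psi u.2)%N else 0%N.
have chiP z : z \in G -> exists h c, [/\ h \in H, c \in C, z = (h * c)%g &
    chi z = (phi h + 2 * M * psi c)%N].
  rewrite -defHC => /mulsgP[h c hH cC ->]; rewrite /chi /dec.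
  case: pickP => [[h' c'] /= /andP[/andP[h'H c'C] /eqP e] | /(_ (h, c)) /=].
    by exists h', c'.
  by rewrite hH cC eqxx.
have lt2 a b : (a < M -> b < M -> a + b < 2 * M)%N by lia.
exists chi; split=> [z /chiP[h [c [hH cC _ ->]]]|].
  apply: (@leq_trans (2 * M * (psi c).+1)); last by rewrite leq_mul2l psiN // orbT.
  by rewrite mulnS ltn_add2r (leq_trans (phiM h hH)) // leq_pmull.
move=> x x' y y' /chiP[h1 [c1 [hH1 cC1 -> ->]]] /chiP[h2 [c2 [hH2 cC2 -> ->]]].
move=> /chiP[h3 [c3 [hH3 cC3 -> ->]]] /chiP[h4 [c4 [hH4 cC4 -> ->]]] e.
have [e1 e2] : (phi h1 + phi h4 = phi h2 + phi h3)%N /\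
               (psi c1 + psi c4 = psi c2 + psi c3)%N.
  apply: (@radix_inj (2 * M)); rewrite ?lt2 ?phiM //.
  by rewrite !mulnDr addnACA e addnACA.
have com h c : h \in H -> c \in C -> (h * c = c * h)%g.
  by move=> hH cC; have /centP/(_ _ hH) := fintype.subsetP cHC _ cC; move->.
have mulHC h c h' c' : c \in C -> h' \in H ->
    (h * c * (h' * c') = h * h' * (c * c'))%g.
  by move=> cC hH; rewrite -!mulgA; congr (_ * _)%g; rewrite !mulgA (com h' c).
by rewrite (mulHC h1 c1) // (mulHC h2 c2) // (phiF h1 h2 h3 h4) // (psiF c1 c2 c3 c4).
Qed.

(** A decomposition into cyclic factors by abelian type has exactly as many factors as the rank, and
    each factor costs one doubling. *)
Lemma freiman_abelian (gT : finGroupType) (G : {group gT}) :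
  abelian G -> exists phi, freiman G (2 ^ 'r(G)%g * #|G|) phi.
Proof.
move=> cGG; have [b defG def_t] := abelian_structure cGG.
rewrite -(size_abelian_type cGG) -def_t size_map {def_t cGG}.
elim: b G defG => [|x b IH] G; rewrite ?big_nil ?big_cons.
  move=> <-; exists (fun _ => 0%N); split=> [x _ | x x' y y'].
    by rewrite cards1.
  by rewrite !inE => /eqP-> /eqP-> /eqP-> /eqP->.
move=> defG; have [[X C defX defC] defXC cXC tiXC] := dprodP defG.
rewrite defC in defG.
have [psi Fpsi] := IH C defC; have [phi Fphi] := freiman_cycle x.
have [chi Fchi] := freiman_dprod defG Fphi Fpsi.
exists chi; move: Fchi; rewrite -(dprod_card defG) -orderE /= expnS.
by congr freiman; rewrite !mulnA; congr (_ * _)%N; rewrite -!mulnA; congr (_ * _)%N; rewrite mulnC.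
Qed.

Lemma card_tagged_pairs (I X : finType) (F : I -> {set X}) :
  #|[set u : I * X | u.2 \in F u.1]| = (\sum_i #|F i|)%N.
Proof.
rewrite -sum1_card; under [RHS]eq_bigr => i _ do rewrite -sum1_card.
rewrite pair_big_dep /=; apply: eq_bigl => u.
by rewrite inE.
Qed.

Lemma sum_card_disjoint (I X : finType) (F : I -> {set X}) :
  (forall i j x, x \in F i -> x \in F j -> i = j) ->
  (\sum_i #|F i| <= #|X|)%N.
Proof.
move=> disj; rewrite -card_tagged_pairs -(card_in_imset (f := snd)) ?max_card //.
move=> [i x] [j y]; rewrite !inE /= => xi yj e.
by rewrite -e in yj *; rewrite (disj i j x).
Qed.

(** The set consists of the images of the pairs in [A i] times [B i]. In a corner, the common first
    coordinate puts the first two points in the same index [i]. The equal differences pull back to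
    [a2 * a^-1 = b1 * b^-1]; the second SDPP condition puts [a2] in [A i], and the first then gives
    [b1 = b], so the difference is 0. *)
Lemma SDPP_skew_corner (gT : finGroupType) (n N : nat)
    (A B : 'I_n -> {set gT}) (phi : gT -> nat) :
  abelian [set: gT]%SET -> SDPP A B -> freiman [set: gT]%SET N phi ->
  exists2 S : {set 'I_N * 'I_N}, skew_corner_free S &
    #|S| = (\sum_i #|A i| * #|B i|)%N.
Proof.
move=> cGG [sdpp1 sdpp2] [phiN phiF].
have com (x y : gT) : (x * y = y * x)%g.
  by have /centsP := cGG; apply; rewrite inE.
pose o x : 'I_N := Ordinal (phiN x (finset.in_setT x)).
have o_inj : injective o.
  move=> x y [] e; apply: (mulIg 1%g).
  by apply: (phiF x y 1%g 1%g); rewrite ?inE // e.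
have A_disj i j a b : a \in A i -> a \in A j -> b \in B j -> i = j.
  by move=> ai aj bj; apply: (sdpp2 i j j a a b b); rewrite // mulgV mul1g mulgV.
pose T := [set u : 'I_n * (gT * gT) | u.2 \in finset.setX (A u.1) (B u.1)].
exists [set (o u.2.1, o u.2.2) | u in T]; last first.
  rewrite card_in_imset; last first.
    move=> [i [a b]] [j [a' b']]; rewrite !inE /= => /andP[ai bi] /andP[aj bj].
    move=> e; have /o_inj ea := congr1 fst e; have /o_inj eb := congr1 snd e.
    rewrite -ea -eb in aj bj *.
    by rewrite (A_disj i j a b).
  rewrite (card_tagged_pairs (fun i => finset.setX (A i) (B i))); apply: eq_bigr => i _.
  by rewrite cardsX.
move=> [x [y [yd [xd [y' [d [[d0 yE xE] [m1 m2 m3]]]]]]]].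
move: m1 m2 m3 => /imsetP[[i [a b]] + [ex ey]] /imsetP[[j [a1 b1]] + [ex1 eyd]].
move=> + + /imsetP[[l [a2 b2]] + [exd _]]; rewrite !inE /=.
move=> /andP[ai bi] /andP[aj bj] /andP[al _].
have ea : a1 = a by apply: o_inj; rewrite -ex1 -ex.
rewrite ea in aj; have eij := A_disj _ _ _ _ ai aj bj; rewrite -eij in bj.
have e : (phi a2 + phi b = phi a + phi b1)%N.
  by move: yE xE; rewrite ex ey eyd exd /=; lia.
have {}e := phiF _ _ _ _ (finset.in_setT _) (finset.in_setT _) (finset.in_setT _) (finset.in_setT _) e.
have e1 : (a2 * a^-1 = b1 * b^-1)%g.
  by apply: (mulIg b); rewrite mulgKV (com a2) -mulgA e mulKg.
have eli : l = i by apply: (sdpp2 l i i a2 a b b1) => //; rewrite e1 mulgKV mulgV.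
rewrite eli in al; have [_ eb] := sdpp1 i a2 a b1 b al ai bj bi e1.
by move: d0 yE; rewrite ey eyd eb; lia.
Qed.

(** * Asymptotics *)

(** Arithmetic-harmonic mean inequality: [r i] is at least [h / u i], and the reciprocals of the
    [u i] add up to at least [n ^ 2 / U]. *)
Lemma harmonic_sum_bound (R : realFieldType) (n : nat) (u r : 'I_n -> R) (h U : R) :
  0 <= h -> 0 < U -> (forall i, 0 < u i) -> \sum_i u i <= U ->
  (forall i, h <= r i * u i) -> h * n%:R ^+ 2 <= U * \sum_i r i.
Proof.
move=> h0 U0 u0 leU hru; pose l : R := n%:R / U.
(* [1 / u >= 2 l - l ^ 2 u], the tangent to [1 / u] at [1 / l] *)
have tangent i : h * (2 * l - l ^+ 2 * u i) <= r i.
  rewrite -(ler_pM2r (u0 i)); apply: le_trans (hru i).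
  rewrite -mulrA ler_piMr // -subr_ge0.
  by have := sqr_ge0 (1 - l * u i); congr (0 <= _); ring.
have sum_tangent : h * (2 * l * n%:R - l ^+ 2 * U) <= \sum_i r i.
  apply: (@le_trans _ _ (\sum_i h * (2 * l - l ^+ 2 * u i))); last exact: ler_sum.
  rewrite -mulr_sumr ler_wpM2l // sumrB sumr_const card_ord -mulr_sumr.
  rewrite -(mulr_natr (2 * l) n).
  by have := ler_wpM2l (sqr_ge0 l) leU; lra.
rewrite -(ler_pM2l U0) in sum_tangent; apply: le_trans sum_tangent.
rewrite le_eqVlt; apply/orP; left; apply/eqP; rewrite /l; field.
by rewrite gt_eqF.
Qed.

(** A single far enough member of the sequence suffices for the contradiction; [X] makes [n] large
    enough to absorb constants. *)
Lemma SDPP_conjecture_instance (R : realType) (eta X : R) :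
  0 < eta < 1 -> SDPP_conjecture R ->
  exists (n : nat) (gT : finGroupType) (A B : 'I_n -> {set gT}),
    [/\ (0 < n)%N, abelian [set: gT]%SET, SDPP A B & X < ln n%:R] /\
    (ln #|gT|%:R <= (2 + eta) * ln n%:R :> R /\
     forall i, (0 < #|A i| * #|B i|)%N /\
       (2 - eta) * ln n%:R <= ln (#|A i| * #|B i|)%:R :> R).
Proof.
move=> /andP[e0 e1] [n [n_gt0 [G [A [B [n_incr cGG sdpp cvgG cvgAB]]]]]].
have n_ge t : (t <= n t)%N.
  by elim: t => // t IH; apply: leq_ltn_trans IH (n_incr _ _ (ltnSn t)).
have /cvgrPdist_lt/(_ _ e0) nearG := cvgG.
have /cvgrPdist_lt/(_ _ e0) nearAB := cvgAB.
have nearX : \forall t \near eventually, expR (`|X| + 1) < t%:R :> R.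
  exact: nbhs_infty_gtr.
have [t0 _ Ht] := filterI nearX (filterI nearG nearAB).
have [/= Xt [Gt ABt]] := Ht t0 (leqnn _).
move: Gt ABt Xt; set t := t0.
set x := ln (n t)%:R => Gt ABt Xt.
have Xx : `|X| + 1 < x.
  rewrite -ltr_expR lnK ?posrE ?ltr0n ?n_gt0 //.
  by apply: lt_le_trans Xt _; rewrite ler_nat n_ge.
have x_gt0 : 0 < x by apply: le_lt_trans Xx; rewrite addr_ge0.
exists (n t), (G t), (A t), (B t); split.
  by split => //; apply: le_lt_trans Xx; rewrite (le_trans (ler_norm X)) // lerDl.
split.
  rewrite -ler_pdivrMr //.
  by move: Gt; rewrite ltr_distlC => /andP[_]; lra.
move=> i.
have lei : min_ord (n_gt0 t) (fun i => ln ((#|A t i| * #|B t i|)%:R : R) / x) <= ln ((#|A t i| * #|B t i|)%:R : R) / x.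
  exact: bigmin_le.
have ABi : (2 - eta) * x < ln ((#|A t i| * #|B t i|)%:R : R).
  rewrite -ltr_pdivlMr //; apply: lt_le_trans lei.
  by move: ABt; rewrite ltr_distl => /andP[]; lra.
split; last exact: ltW.
(* An empty set would give [ln 0 = 0], below the positive lower bound. *)
rewrite lt0n; apply: contraTneq ABi => ->; rewrite ln0 // -leNgt.
by rewrite mulr_ge0 // ?ltW // subr_gt0 (lt_trans e1) // ltr1n.
Qed.

(** The left side is the size of a skew corner-free set in a square of side [N = 2 ^ k * #|gT|],
    with [k] the rank; the right side is [N] to the power 4/3, times the absolute value of [C]. *)
Lemma small_rank_bound (R : realType) (eps C : R) (gT : finGroupType) (n : nat)
    (A B : 'I_n -> {set gT}) :
  0 < eps ->
  (forall N : nat, (0 < N)%N ->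
     forall S : {set 'I_N * 'I_N}, skew_corner_free S ->
       #|S|%:R <= C * N%:R `^ (4 / 3 - eps)) ->
  abelian [set: gT]%SET -> SDPP A B ->
  (\sum_i #|A i| * #|B i|)%:R <=
    `|C| * expR (4 / 3 * (ln 2 * ('r([set: gT]%SET)%g)%:R + ln #|gT|%:R)).
Proof.
move=> eps0 bound cGG sdpp; have [phi phiF] := freiman_abelian (G := [set: gT]%G) cGG.
rewrite cardsT in phiF; set k := 'r(_)%g in phiF *.
have G_gt0 : (0 < #|gT|)%N by apply/card_gt0P; exists 1%g.
have N_gt0 : (0 < 2 ^ k * #|gT|)%N by rewrite muln_gt0 expn_gt0.
have [S Sfree <-] := SDPP_skew_corner cGG sdpp phiF.
apply: le_trans (bound _ N_gt0 _ Sfree) _.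
apply: (@le_trans _ _ (`|C| * (2 ^ k * #|gT|)%:R `^ (4 / 3 - eps))).
  by rewrite ler_wpM2r ?powR_ge0 // ler_norm.
rewrite ler_wpM2l //.
apply: (@le_trans _ _ ((2 ^ k * #|gT|)%:R `^ (4 / 3))).
  by rewrite ler_powR ?ler1n //; lra.
rewrite /powR pnatr_eq0 gtn_eqF // natrM lnM ?posrE ?ltr0n ?expn_gt0 //.
by rewrite natrX lnXn // -(mulr_natr (ln 2)).
Qed.

(** As [M] is at most [L / 2], each [r i * (#|A i| + #|B i|)] is at least [L / 2]. The [A i] are
    disjoint, and so are the [B i], so these block sizes add up to at most [2 * #|gT|], and the
    harmonic bound applies. *)
Lemma large_rank_bound (R : realType) (gT : finGroupType) (n : nat)
    (A B : 'I_n -> {set gT}) (L : R) (M : nat) (r : 'I_n -> nat) :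
  SDPP A B ->
  (forall i, (0 < #|A i| * #|B i|)%N) ->
  (forall i, L <= (#|A i| * #|B i|)%:R) ->
  0 <= L -> 2 * M%:R <= L ->
  (\sum_i r i <= 4 * M)%N ->
  (forall i, (#|A i| * #|B i| <= r i * (#|A i| + #|B i|) + M)%N) ->
  L * n%:R ^+ 2 <= 16 * #|gT|%:R * M%:R.
Proof.
move=> [_ sdpp2] AB_gt0 leL L0 leM ler4 ler.
have neA i : exists a, a \in A i by apply/card_gt0P; have := AB_gt0 i; rewrite muln_gt0 => /andP[].
have neB i : exists b, b \in B i by apply/card_gt0P; have := AB_gt0 i; rewrite muln_gt0 => /andP[].
have sumA : (\sum_i #|A i| <= #|gT|)%N.
  apply: sum_card_disjoint => i j a ai aj; have [b bj] := neB j.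
  by apply: (sdpp2 i j j a a b b); rewrite // mulgV mul1g mulgV.
have sumB : (\sum_i #|B i| <= #|gT|)%N.
  apply: sum_card_disjoint => i j b bi bj; have [a ai] := neA i.
  by apply: (sdpp2 i i j a a b b); rewrite // mulgV mul1g mulgV.
have G_gt0 : (0 < #|gT|)%N by apply/card_gt0P; exists 1%g.
have := @harmonic_sum_bound R n (fun i => (#|A i| + #|B i|)%:R) (fun i => (r i)%:R) (L / 2) (2 * #|gT|%:R).
move=> H.
have {}H : L / 2 * n%:R ^+ 2 <= 2 * #|gT|%:R * (\sum_i r i)%:R.
  rewrite natr_sum; apply: H.
  - by rewrite divr_ge0.
  - by rewrite mulr_gt0 // ltr0n.
  - by move=> i; rewrite ltr0n addn_gt0; have := AB_gt0 i; rewrite muln_gt0 => /andP[->].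
  - rewrite -natr_sum -natrM ler_nat big_split /= mul2n -addnn; exact: leq_add.
  move=> i; have := ler i; rewrite -(ler_nat R) natrD natrM => ri.
  by have := leL i; lra.
have : (\sum_i r i)%:R <= 4 * M%:R :> R by rewrite -natrM ler_nat.
have : 0 < #|gT|%:R :> R by rewrite ltr0n.
by move=> G0 rM; have := ler_wpM2l (ltW G0) rM; lra.
Qed.

(** The saving is 1/240 = 1/(3 * 5 * 16): a cube root, the estimate [2 <= (32/27) ^ 5], and the rank
    threshold 1/16. *)
Lemma slice_count_saving (R : realType) (k M g : nat) : (0 < g)%N ->
  ln g%:R / 16 < ln 2 * k%:R :> R ->
  32 ^+ k * M%:R ^+ 3 <= 27 ^+ k * g%:R ^+ 3 :> R ->
  M%:R <= expR (ln g%:R - ln g%:R / 240) :> R.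
Proof.
move=> g0 large le; have [-> | M0] := posnP M; first exact: expR_ge0.
have ln32 : ln 2 / 5 <= ln 32 - ln 27 :> R.
  rewrite ler_pdivrMr // mulrC mulr_natl.
  rewrite -ln_div ?posrE // -lnXn ?divr_gt0 // ler_ln ?posrE //.
  by rewrite expr_div_n ler_pdivlMr ?exprn_gt0 //; lra.
have lnMX (a b : R) : 0 < a -> 0 < b ->
    ln (a ^+ k * b ^+ 3) = ln a * k%:R + ln b * 3.
  move=> a0 b0; rewrite lnM ?posrE ?exprn_gt0 // (lnXn k) // (lnXn 3) //.
  by rewrite -(mulr_natr (ln a)) -(mulr_natr (ln b)).
have := le; rewrite -ler_ln ?posrE ?mulr_gt0 ?exprn_gt0 ?ltr0n //.
rewrite !lnMX ?ltr0n // => leln.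
have {leln} lnM : ln M%:R <= ln g%:R - ln g%:R / 240 :> R.
  have := ler_wpM2r (ler0n R k) ln32; lra.
by rewrite -(@lnK _ M%:R) ?posrE ?ltr0n // ler_expR.
Qed.

Theorem theorem1p4 (R : realType)
  (skew_bound : exists eps C : R, 0 < eps /\
     forall n : nat, (0 < n)%N ->
     forall S : {set 'I_n * 'I_n}, skew_corner_free S ->
       #|S|%:R <= C * n%:R `^ (4 / 3 - eps)) :
  ~ SDPP_conjecture R.
Proof.
move=> conj; have [eps [C [eps0 bound]]] := skew_bound.
have eta01 : 0 < (1 / 1000 : R) < 1 by apply/andP; split; lra.
(* With this threshold, the absolute value of [C] and the constants 2 and 16 all lie below [n] to
   the power 1/200. The errors 1/1000 and 1/200 fit within the saving of about 2/240 in the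
   large-rank case. *)
have [n [gT [A [B [[n_gt0 cGG sdpp ltX] [leG geAB]]]]]] :=
  @SDPP_conjecture_instance R _ (200 * ln (`|C| + 17)) eta01 conj.
set x := ln n%:R in ltX leG geAB; set g := ln #|gT|%:R in leG.
have nE : n%:R = expR x by rewrite lnK // posrE ltr0n.
have G_gt0 : (0 < #|gT|)%N by apply/card_gt0P; exists 1%g.
have GE : #|gT|%:R = expR g by rewrite lnK // posrE ltr0n.
have C17 : 0 < `|C| + 17 by rewrite ltr_wpDl.
have exp_gt : `|C| + 17 < expR (x / 200).
  by rewrite -[ltLHS]lnK ?posrE // ltr_expR; lra.
have x_gt0 : 0 < x.
  have : 0 <= ln (`|C| + 17) by rewrite ln_ge0 // ler_wpDl // ler1n.
  by lra.
have leAB i : expR ((2 - 1 / 1000) * x) <= (#|A i| * #|B i|)%:R.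
  have [ABi leABi] := geAB i.
  by rewrite -[leRHS]lnK ?posrE ?ltr0n // ler_expR.
have AB_gt0 i : (0 < #|A i| * #|B i|)%N by have [] := geAB i.
set k := 'r([set: gT]%SET)%g.
have [small | large] := lerP (ln 2 * k%:R) (g / 16).
  have := small_rank_bound eps0 bound cGG sdpp; rewrite -/k -/g; apply/negP; rewrite -ltNge.
  apply: (@lt_le_trans _ _ (expR (x + (2 - 1 / 1000) * x))); last first.
    rewrite expRD -nE natr_sum mulr_natl -[X in _ *+ X](card_ord n) -sumr_const.
    exact: ler_sum.
  (* Here 17/12 is 4/3 times 17/16, since [2 ^ k * #|gT|] is at most [#|gT|] to the power 17/16. The
     resulting exponent is about 2.83, against almost 3 from the pairs. *)
  apply: (@le_lt_trans _ _ (`|C| * expR (17 / 12 * (2 + 1 / 1000) * x))).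
    by rewrite ler_wpM2l // ler_expR; lra.
  apply: (@lt_le_trans _ _ (expR (x / 200) * expR (17 / 12 * (2 + 1 / 1000) * x))).
    by rewrite ltr_pM2r ?expR_gt0 //; lra.
  by rewrite -expRD ler_expR; lra.
have [M [r [leM sum_r le_r]]] := SDPP_rank_bound R cGG sdpp.
have {leM large} := slice_count_saving G_gt0 large leM; rewrite -/g => leM.
have e17 : 17 < expR (x / 200) by have := normr_ge0 C; lra.
have M2 : 2 * M%:R <= expR ((2 - 1 / 1000) * x).
  apply: (@le_trans _ _ (expR (x / 200) * expR (g - g / 240))).
    by rewrite ler_pM // ltW // (lt_trans _ e17) //; lra.
  by rewrite -expRD ler_expR; lra.
have := large_rank_bound sdpp AB_gt0 leAB (expR_ge0 _) M2 sum_r le_r.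
(* The left side has exponent 4 - 1/1000 in [n], the right side at most (2 + 1/1000) * (2 - 1/240)
   plus 1/200 for the factor 16. *)
apply/negP; rewrite -ltNge nE GE.
apply: (@le_lt_trans _ _ (16 * expR g * expR (g - g / 240))).
  by rewrite ler_wpM2l // mulr_ge0 // expR_ge0.
rewrite -mulrA -expRD -expRM_natl -expRD.
apply: (@lt_le_trans _ _ (expR (x / 200) * expR (g + (g - g / 240)))).
  by rewrite ltr_pM2r ?expR_gt0 //; lra.
by rewrite -expRD ler_expR; lra.
Qed.
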